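(* Let $\Omega\subset\mathbb R^m$ be the projected spectrahedron $$\Omega=\Big\{v\in\mathbb R^m:\ \exists\,\xi\in\mathbb R^N,\ F_0+\sum_{i=1}^mv_iF_i+\sum_{t=1}^N\xi_tM_t\succeq0\Big\},\qquad F_i,M_t\in\mathbb S^\nu,$$ let $g_\ell^k$ ($\ell=1,\ldots,L$, $k=1,\ldots,r$) and $h_j$ ($j=1,\ldots,J$) be SOS-convex polynomials on $\mathbb R^m$, and let $\gamma_1,\ldots,\gamma_J\in\mathbb R$. Consider the moment problem (P) and the semi-definite programs (R) and (S) given in the context. Assume: (a) $\Omega$ is compact and there exist $\bar v\in\mathbb R^m$, $\bar\xi\in\mathbb R^N$ with $F_0+\sum_{i=1}^m\bar v_iF_i+\sum_{t=1}^N\bar\xi_tM_t\succ0$; (b) $(\gamma_1,\ldots,\gamma_J,1)\in\operatorname{int}\Big\{\big\{\big(\int_\Omega h_1\,d\mu,\ldots,\int_\Omega h_J\,d\mu,\int_\Omega1\,d\mu\big):\mu\in X,\ \mu\succeq_{\mathcal B}0\big\}+\mathbb R_+^J\times\{0\}\Big\}$ (interior in $\mathbb R^{J+1}$); (c) (P) admits a minimizer; (d) $\max\text{(R)}=\min\text{(S)}$. Let $(\bar y^k,\bar\xi^k,\bar z^k)\in\mathbb R^{s(m,d)}\times\mathbb R^N\times\mathbb R$, $\bar y^k=(\bar y^k_\alpha)_{\alpha\in\mathcal N}$, $k=1,\ldots,r$, be a minimizer for (S) with $\bar y_0^k\ge0$ for all $k=1,\ldots,r$. Put $K:=\{k\in\{1,\ldots,r\}:\bar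 y_0^k>0\}$ and $\widehat u^k:=\frac1{\bar y_0^k}(\bar y_{e_1}^k,\ldots,\bar y_{e_m}^k)\in\mathbb R^m$ for $k\in K$. Suppose that for all $k\in\{1,\ldots,r\}\setminus K$, $$\bar z^k\ge0\quad\text{and}\quad\sum_{\alpha\in\mathcal N}\bar y_\alpha^k(h_j)_\alpha\ge0\ \text{ for all }j=1,\ldots,J.$$ Then $\widehat\mu:=\sum_{k\in K}\bar y_0^k\,\mathbf 1_{\widehat u^k}$, where $\mathbf 1_u$ denotes the Dirac measure at $u$, is a minimizer for (P).
   Context: $X$ is the vector space of finite signed regular Borel measures on $(\Omega,\mathcal B)$, where $\mathcal B$ is the Borel $\sigma$-algebra of $\Omega$; $\mu\succeq_{\mathcal B}0$ means $\mu(A)\ge0$ for all $A\in\mathcal B$. $\mathbb S^\nu$ is the space of real symmetric $\nu\times\nu$ matrices, $\mathbb S_+^\nu$ its cone of positive semi-definite matrices; $\succeq0$, $\succ0$ mean positive semi-definite, positive definite. $\Delta=\{\delta\in\mathbb R^L:\delta_\ell\ge0,\ \sum_\ell\delta_\ell=1\}$. A real polynomial $f$ on $\mathbb R^m$ is SOS-convex if its Hessian $H(v)$ equals $P(v)^\top P(v)$ for some $s\times m$ matrix $P(v)$ with polynomial entries and some $s\in\mathbb N$. The moment problem is $$\text{(P)}\quad\min_{\mu\in X}\Big\{\int_\Omega\min_{k=1,\ldots,r}\max_{\ell=1,\ldots,L}g_\ell^k\,d\mu:\ \int_\Omega h_j\,d\mu\le\gamma_j\ (j=1,\ldots,J),\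 \int_\Omega1\,d\mu=1,\ \mu\succeq_{\mathcal B}0\Big\}.$$ Let $d$ be the smallest even integer with $d\ge\max\{\max_{k,\ell}\deg g_\ell^k,\max_j\deg h_j\}$, and assume $d\ge2$. Let $\mathcal N=\{\alpha\in\{0,1,2,\ldots\}^m:\sum_i\alpha_i\le d\}$ and $s(m,d)=\binom{m+d}{d}$ (the cardinality of $\mathcal N$); $e_i$ is the $i$-th standard unit multi-index. For a polynomial $f$ of degree at most $d$, $(f)_\alpha$ is the coefficient of $v^\alpha$; $(1)_\alpha$ is $1$ if $\alpha=0$ and $0$ otherwise. Let $y(v)$ be the column vector of all monomials in $v$ of degree at most $d/2$; the matrices $B_\alpha\in\mathbb S^{s(m,d/2)}$ are defined by $y(v)y(v)^\top=\sum_{\alpha\in\mathcal N}B_\alpha v^\alpha$. Set $F_\alpha:=F_0$ for $\alpha=0$, $F_{e_i}:=F_i$ for $i=1,\ldots,m$, and $F_\alpha:=0$ for all other $\alpha\in\mathcal N$. (R): maximize $-\sum_{j=1}^J\lambda_j\gamma_j-\lambda_{J+1}$ over $\lambda\in\mathbb R_+^J\times\mathbb R$, $\delta^k\in\Delta$, $Z_k\in\mathbb S_+^\nu$, $Q_k\in\mathbb S_+^{s(m,d/2)}$ ($k=1,\ldots,r$) subject to $$\sum_{\ell=1}^L\delta_\ell^k(g_\ell^k)_\alpha+\sum_{j=1}^J\lambda_j(h_j)_\alpha+\lambda_{J+1}(1)_\alpha-\operatorname{tr}(Z_kF_\alpha)=\operatorname{tr}(Q_kB_\alpha),\quad\alpha\in\mathcal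 N,\ k=1,\ldots,r,$$ and $\operatorname{tr}(Z_kM_t)=0$ for $t=1,\ldots,N$, $k=1,\ldots,r$. (S): minimize $\sum_{k=1}^rz^k$ over $y^k=(y^k_\alpha)_{\alpha\in\mathcal N}\in\mathbb R^{s(m,d)}$, $\xi^k\in\mathbb R^N$, $z^k\in\mathbb R$ ($k=1,\ldots,r$) subject to $$\sum_{k=1}^r\sum_{\alpha\in\mathcal N}y_\alpha^k(h_j)_\alpha\le\gamma_j\ (j=1,\ldots,J),\qquad\sum_{\alpha\in\mathcal N}y_\alpha^k(g_\ell^k)_\alpha\le z^k\ (\ell=1,\ldots,L,\ k=1,\ldots,r),$$ $$y_0^kF_0+\sum_{i=1}^my_{e_i}^kF_i+\sum_{t=1}^N\xi_t^kM_t\succeq0\ (k=1,\ldots,r),\qquad\sum_{k=1}^ry_0^k=1,\qquad\sum_{\alpha\in\mathcal N}y_\alpha^kB_\alpha\succeq0\ (k=1,\ldots,r).$$ *)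

(* Defs.v *)
From HB Require Import structures.
From mathcomp Require Import all_boot all_order all_algebra.
From mathcomp Require Import all_classical all_reals all_analysis.
(* The notations of mpoly clash with those of mathcomp-analysis, hence the
   qualified names mpoly.* below. *)
From mathcomp Require Import(canonicals,coercions) mpoly.

Set Implicit Arguments.
Unset Strict Implicit.
Unset Printing Implicit Defensive.

Import Order.TTheory GRing.Theory Num.Theory numFieldNormedType.Exports.
Local Open Scope classical_set_scope.
Local Open Scope ring_scope.

Definition minimizer d (V : porderType d) T (S : set T) (f : T -> V) (x : T) :=
  S x /\ forall y, S y -> (f x <= f y)%O.

Definition maximizer d (V : porderType d) T (S : set T) (f : T -> V) (x : T) :=
  S x /\ forall y, S y -> (f y <= f x)%O.

Section Matrices.
Variables (R : realType) (n : nat).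
Implicit Type A : 'M[R]_n.

Definition sym_mx A := A^T = A.

Definition psd_mx A :=
  sym_mx A /\ forall x : 'cV[R]_n, 0 <= (x^T *m A *m x) 0 0.

Definition pd_mx A :=
  sym_mx A /\ forall x : 'cV[R]_n, x != 0 -> 0 < (x^T *m A *m x) 0 0.

End Matrices.

Section Polynomials.
Variables (R : realType) (m : nat).
Local Notation Pol := (mpoly.mpoly m R).

(* Value of p at the point v of R^m, points being row vectors. *)
Definition peval (p : Pol) (v : 'rV[R]_m) : R := mpoly.meval (fun i => v 0 i) p.

(* msize p is one more than the degree of p; the zero polynomial gets degree 0. *)
Definition pdeg (p : Pol) : nat := (mpoly.msize p).-1.

Definition hessian (p : Pol) : 'M[Pol]_m :=
  \matrix_(i, j) mpoly.mderiv i (mpoly.mderiv j p).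

Definition sos_convex (p : Pol) :=
  exists (s : nat) (P : 'M[Pol]_(s, m)), hessian p = P^T *m P.

End Polynomials.

Section Moments.
Variables (R : realType) (m d : nat).

(* The index set N of the exponents of total degree at most d. *)
Definition expo := mpoly.bmultinom m d.+1.

(* y_b for an arbitrary exponent b; 0 when b is not in N. *)
Definition at_expo (y : expo -> R) (b : mpoly.multinom m) : R :=
  oapp y 0 (insub b).

(* 'I_half_size indexes the monomials of degree at most d/2, of which there are
   binomial(m + d/2, d/2). *)
Definition half_size := #|{: mpoly.bmultinom m (d./2).+1}|.

Definition monomials : 'cV[mpoly.mpoly m R]_half_size :=
  \col_i mpoly.mpolyX R (enum_val i : mpoly.bmultinom m (d./2).+1).

(* B_a is the coefficient of v^a in the polynomial matrix y(v) y(v)^T. *)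
Definition Bmx (a : expo) : 'M[R]_half_size :=
  map_mx (mpoly.mcoeff a) (monomials *m monomials^T).

Lemma BmxE : monomials *m monomials^T =
  \sum_(a : expo) map_mx (fun c : R => c *: mpoly.mpolyX R a) (Bmx a).
Proof.
apply/matrixP => i j; rewrite summxE !mxE big_ord1 !mxE -mpoly.mpolyXD.
set b := mpoly.mnm_add _ _.
have lebd : (mpoly.mdeg b < d.+1)%N.
  rewrite /b mpoly.mdegD ltnS -[leqRHS]odd_double_half -addnn.
  have := mpoly.bmdeg (enum_val i : mpoly.bmultinom m (d./2).+1).
  have := mpoly.bmdeg (enum_val j : mpoly.bmultinom m (d./2).+1).
  rewrite !ltnS => hj hi; apply: (leq_trans (leq_add hi hj)).
  exact: leq_addl.
rewrite (bigD1 (mpoly.BMultinom lebd)) //= big1 => [|a ab].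
  by rewrite addr0 !mxE big_ord1 !mxE -mpoly.mpolyXD mpoly.mcoeffX eqxx scale1r.
rewrite !mxE big_ord1 !mxE -mpoly.mpolyXD mpoly.mcoeffX -/b.
case: eqP => [ba|_]; last by rewrite scale0r.
by move/eqP: ab; case; apply/val_inj.
Qed.

End Moments.

(* d is the smallest even integer bounding the degrees of all g k l and h j. *)
Definition least_even_degree (R : realType) (m r L J : nat)
    (g : 'I_r -> 'I_L -> mpoly.mpoly m R) (h : 'I_J -> mpoly.mpoly m R)
    (d : nat) :=
  let even_bound e := [/\ ~~ odd e,
    forall k l, (pdeg (g k l) <= e)%N & forall j, (pdeg (h j) <= e)%N] in
  even_bound d /\ forall e, even_bound e -> (d <= e)%N.

Section Spectrahedron.
Variables (R : realType) (m N nu : nat).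
Variables (F0 : 'M[R]_nu) (F : 'I_m -> 'M[R]_nu) (M : 'I_N -> 'M[R]_nu).

Definition pencil (v : 'rV[R]_m) (xi : 'rV[R]_N) : 'M[R]_nu :=
  F0 + \sum_i v 0 i *: F i + \sum_t xi 0 t *: M t.

Definition proj_spectrahedron : set 'rV[R]_m :=
  [set v | exists xi, psd_mx (pencil v xi)].

Lemma slater_nonempty :
  (exists v xi, pd_mx (pencil v xi)) -> proj_spectrahedron !=set0.
Proof.
move=> [v [xi [symA posA]]]; exists v; exists xi; split=> // x.
by have [->|/posA/ltW//] := eqVneq x 0; rewrite mulmx0 mxE.
Qed.

(* F_a for a multi-index a: F_0, F_{e_i} = F_i, and 0 otherwise. *)
Definition Fexpo (a : mpoly.multinom m) : 'M[R]_nu :=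
  if a == mpoly.mnm0 then F0
  else if [pick i | a == mpoly.mnm1 i] is Some i then F i else 0.

End Spectrahedron.

(* A nonempty subset A of a topological space as a topological space on its own,
   and the measurable space (A, Borel sigma-algebra of A). The nonemptiness proof
   is there because measurable types of the library are pointed. *)
Section BorelSubspace.
Variables (X : topologicalType) (A : set X).

Definition subspace_of of A !=set0 : Type := set_type A.

Variable A0 : A !=set0.

HB.instance Definition _ := Topological.copy (subspace_of A0) (set_type A).

Definition subspace_point : subspace_of A0 :=
  let a := cid A0 in SigSub (mem_set (svalP a)).

HB.instance Definition _ := isPointed.Build (subspace_of A0) subspace_point.

Definition borel := g_sigma_algebraType (@open (subspace_of A0)).

Definition borel_val (w : borel) : X := set_val (w : set_type A).

End BorelSubspace.

Section SignedMeasures.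
Context d (T : measurableType d) (R : realType).
Local Open Scope ereal_scope.
Implicit Type mu : {charge set T -> \bar R}.

Definition hahn_pos mu : set T := sval (cid (Hahn_decomposition mu)).

Definition hahn_neg mu : set T :=
  sval (cid (svalP (cid (Hahn_decomposition mu)))).

Definition hahn_posneg mu :
  hahn_decomposition mu (hahn_pos mu) (hahn_neg mu) :=
  svalP (cid (svalP (cid (Hahn_decomposition mu)))).

(* Integral of f against mu = mu^+ - mu^- (Jordan decomposition). *)
Definition charge_integral mu (f : T -> R) : \bar R :=
  \int[jordan_pos (hahn_posneg mu)]_w (f w)%:E -
  \int[jordan_neg (hahn_posneg mu)]_w (f w)%:E.

Definition charge_ge0 mu := forall A : set T, measurable A -> 0 <= mu A.

Definition dirac_charge (w : T) : {charge set T -> \bar R} :=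
  charge_of_finite_measure (dirac w).

Definition dirac_comb (I : finType) (P : pred I) (c : I -> R) (u : I -> T) :
    {charge set T -> \bar R} :=
  \big[(fun mu nu => cadd mu nu : {charge set T -> \bar R})/
       (czero : {charge set T -> \bar R})]_(i | P i)
     (cscale (c i) (dirac_charge (u i)) : {charge set T -> \bar R}).

Lemma dirac_combE (I : finType) (P : pred I) (c : I -> R) (u : I -> T)
    (A : set T) :
  dirac_comb P c u A = \sum_(i | P i) (c i)%:E * \d_(u i) A.
Proof.
rewrite /dirac_comb.
by elim/big_rec2: _ => //= i x mu _ <-.
Qed.

End SignedMeasures.

(* X: the finite signed Borel measures on A whose total variation is regular. *)
Definition regular_charge (R : realType) (X : topologicalType) (A : set X)
    (A0 : A !=set0) (mu : {charge set (borel A0) -> \bar R}) :=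
  forall (E : set (borel A0)) (e : R), measurable E -> 0 < e ->
    exists K U : set (subspace_of A0),
      [/\ compact K, open U, K `<=` E, E `<=` U &
          (charge_variation (hahn_posneg mu) (U `\` K) < e%:E)%E].

Section MomentProblem.
Variables (R : realType) (m r L J : nat).
Variables (g : 'I_r.+1 -> 'I_L.+1 -> mpoly.mpoly m R).
Variables (h : 'I_J -> mpoly.mpoly m R) (gamma : 'I_J -> R).
Variables (Omega : set 'rV[R]_m) (Omega0 : Omega !=set0).

(* The index sets {1,..,r} and {1,..,L}, over which min and max are taken, are
   nonempty: they are rendered by 'I_r.+1 and 'I_L.+1. *)
Definition minmax (v : 'rV[R]_m) : R :=
  let maxg k := \big[Num.max/peval (g k ord0) v]_l peval (g k l) v in
  \big[Num.min/maxg ord0]_k maxg k.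

Local Notation measureX := (charge (borel Omega0) R).

(* Integral over Omega of the restriction of a function defined on R^m. *)
Definition integral_on (mu : measureX) (f : 'rV[R]_m -> R) : \bar R :=
  charge_integral mu (fun w => f (borel_val w)).

Definition P_feasible : set measureX := [set mu |
  [/\ regular_charge mu,
      forall j, (integral_on mu (peval (h j)) <= (gamma j)%:E)%E,
      integral_on mu (cst 1) = 1%E &
      charge_ge0 mu]].

Definition P_objective (mu : measureX) : \bar R := integral_on mu minmax.

(* R^J x R is 'rV_(J + 1), the last coordinate being that of the total mass. *)
Definition moment_cone : set 'rV[R]_(J + 1) := [set p |
  exists mu : measureX, [/\ regular_charge mu, charge_ge0 mu,
    forall j, integral_on mu (peval (h j)) = (p 0 (lshift 1 j))%:E &
    integral_on mu (cst 1) = (p 0 (rshift J ord0))%:E]].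

Definition orthant : set 'rV[R]_(J + 1) := [set p |
  (forall j : 'I_J, 0 <= p 0 (lshift 1 j)) /\ p 0 (rshift J ord0) = 0].

Definition interior_condition :=
  interior [set p + q | p in moment_cone & q in orthant]
    (row_mx (\row_j gamma j) (const_mx 1)).

End MomentProblem.

Arguments P_feasible {R m J} h gamma {Omega} Omega0.
Arguments P_objective {R m r L} g {Omega} Omega0.

Section Relaxations.
Variables (R : realType) (m N nu r L J d : nat).
Variables (F0 : 'M[R]_nu) (F : 'I_m -> 'M[R]_nu) (M : 'I_N -> 'M[R]_nu).
Variables (g : 'I_r.+1 -> 'I_L.+1 -> mpoly.mpoly m R).
Variables (h : 'I_J -> mpoly.mpoly m R) (gamma : 'I_J -> R).

(* The component lambda_{J+1} is separated as Rmass. *)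
Record Rvar := MkRvar {
  Rlambda : 'I_J -> R;
  Rmass : R;
  Rdelta : 'I_r.+1 -> 'I_L.+1 -> R;
  RZ : 'I_r.+1 -> 'M[R]_nu;
  RQ : 'I_r.+1 -> 'M[R]_(half_size m d) }.

Definition R_feasible : set Rvar := [set x |
  (forall j, 0 <= Rlambda x j) /\
  forall k,
    [/\ (forall l, 0 <= Rdelta x k l) /\ \sum_l Rdelta x k l = 1,
        psd_mx (RZ x k),
        psd_mx (RQ x k),
        forall a : expo m d,
          \sum_l Rdelta x k l * mpoly.mcoeff a (g k l)
          + \sum_j Rlambda x j * mpoly.mcoeff a (h j)
          + Rmass x * mpoly.mcoeff a 1
          - \tr (RZ x k *m Fexpo F0 F a)
          = \tr (RQ x k *m Bmx R a) &
        forall t, \tr (RZ x k *m M t) = 0]].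

Definition R_objective (x : Rvar) : R :=
  - \sum_j Rlambda x j * gamma j - Rmass x.

Record Svar := MkSvar {
  Sy : 'I_r.+1 -> expo m d -> R;
  Sxi : 'I_r.+1 -> 'rV[R]_N;
  Sz : 'I_r.+1 -> R }.

(* sum over a in N of y_a (f)_a *)
Definition riesz (y : expo m d -> R) (f : mpoly.mpoly m R) : R :=
  \sum_(a : expo m d) y a * mpoly.mcoeff a f.

Definition y0 (y : expo m d -> R) : R := at_expo y mpoly.mnm0.

Definition y1 (y : expo m d -> R) (i : 'I_m) : R := at_expo y (mpoly.mnm1 i).

Definition S_feasible : set Svar := [set x |
  [/\ forall j, \sum_k riesz (Sy x k) (h j) <= gamma j,
      forall l k, riesz (Sy x k) (g k l) <= Sz x k,
      forall k, psd_mx (y0 (Sy x k) *: F0 + \sum_i y1 (Sy x k) i *: F i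
                        + \sum_t Sxi x k 0 t *: M t),
      \sum_k y0 (Sy x k) = 1 &
      forall k, psd_mx (\sum_(a : expo m d) Sy x k a *: Bmx R a)]].

Definition S_objective (x : Svar) : R := \sum_k Sz x k.

End Relaxations.

Arguments S_objective {R m N r d}.

(* Main.v *)
From HB Require Import structures.
Require Import Defs.
From mathcomp Require Import all_boot all_order all_algebra.
From mathcomp Require Import all_classical all_reals all_analysis.
From mathcomp Require Import(canonicals,coercions) mpoly.
From mathcomp Require polyrcf.
From mathcomp Require Import measurable_realfun lra ring.

Import Order.TTheory GRing.Theory Num.Theory numFieldNormedType.Exports.
Local Open Scope classical_set_scope.
Local Open Scope ring_scope.

Set Implicit Arguments.
Unset Strict Implicit.
Unset Printing Implicit Defensive.

(** The proof is a chain of two inequalities that meets at max (R) = min (S).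

    Weak duality: every feasible point of (R) bounds (P) from below.  The
    moments y_a = v^a of a point v of Omega turn the coefficient equations of
    (R) into
      sum_l delta_l g_l(v) + sum_j lambda_j h_j(v) + lambda_(J+1)
        = tr (Z (F_0 + sum_i v_i F_i)) + tr (Q y(v) y(v)^T),
    and since Z annihilates every M_t, the first trace is also that of Z times
    the whole pencil at (v, xi), where xi is a witness of v in Omega.  Both
    traces are nonnegative ([psd_trace_ge0]), so the left-hand side is
    nonnegative on Omega, for each k ([lagrangian_ge0]).  A convex combination
    is at most a maximum, so the minmax function satisfies the same inequality
    ([minmax_ge_lagrange]), which is then integrated against a nonnegative
    measure ([weak_duality]).

    Upper bound: the measure built from a minimizer of (S) is feasible for (P)
    and does not exceed min (S).  For k in K, dividing the k-th linear matrix
    inequality of (S) by y_0 shows that the point uhat lies in Omega.  The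
    normalized Riesz functional of y takes nonnegative values on squares of
    polynomials of degree at most d/2 ([moment_psd_sqr]), and such a functional
    satisfies the Jensen inequality f(uhat) <= L(f) for SOS-convex f
    ([sos_convex_jensen]).  To see it, restrict f to the segments from uhat to
    the variable point: phi(s) = L(f(uhat + s (X - uhat))) is a polynomial in
    one real variable with phi(0) = f(uhat), phi'(0) = 0 and phi(1) = L(f), and
    the factorization of the Hessian exhibits phi''(s) as L of a sum of squares,
    so that phi is convex.  The inequality applied to the h_j gives the moment
    constraints, and applied to the g_l it gives
    y_0 * max_l g_l(uhat) <= z.  The blocks k outside K contribute nothing to the
    measure, and the sign conditions on them say that dropping them only
    decreases the sums.

    Compactness of Omega makes the continuous integrands integrable against any
    finite Borel measure, and a finite combination of Dirac measures is regular
    because finite sets are compact with open complement. *)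

(** * Degrees of multivariate polynomials *)

Section Degrees.
Variables (R : realType) (m : nat).
Local Notation Pol := (mpoly.mpoly m R).
Local Notation msize := (@mpoly.mmeasure m R mpoly.mdeg).
Implicit Types p q : Pol.

Lemma msizeD_leq a p q :
  (msize p <= a)%N -> (msize q <= a)%N -> (msize (p + q) <= a)%N.
Proof.
by move=> hp hq; rewrite (leq_trans (mpoly.msizeD_le p q))// geq_max hp.
Qed.

Lemma msize_sum_leq (I : finType) a (F : I -> Pol) :
  (forall i, msize (F i) <= a)%N -> (msize (\sum_i F i) <= a)%N.
Proof.
move=> hF; elim/big_ind: _ => //[|p q]; last exact: msizeD_leq.
by rewrite mpoly.mmeasure0.
Qed.

Lemma msizeM_leq a b p q : (msize p <= a.+1)%N -> (msize q <= b.+1)%N ->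
  (msize (p * q) <= (a + b).+1)%N.
Proof.
have [->|p0] := eqVneq p 0; first by rewrite mul0r mpoly.mmeasure0.
have [->|q0] := eqVneq q 0; first by rewrite mulr0 mpoly.mmeasure0.
rewrite mpoly.msizeM// -!mpoly.mlead_deg// addSn addnS /= !ltnS.
exact: leq_add.
Qed.

Lemma msizeX_leq n p : (msize p <= 2)%N -> (msize (p ^+ n) <= n.+1)%N.
Proof.
move=> hp; elim: n => [|n ih]; first by rewrite expr0 mpoly.mmeasure1.
by rewrite exprS -[n.+1]add1n msizeM_leq.
Qed.

Lemma msize_mmap1_affine (l : 'I_m -> Pol) (a : mpoly.multinom m) :
  (forall i, msize (l i) <= 2)%N ->
  (msize (mpoly.mmap1 l a) <= (mpoly.mdeg a).+1)%N.
Proof.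
move=> hl; rewrite /mpoly.mmap1 mpoly.mdegE.
elim/big_rec2: _ => [|i p n _ ih]; first by rewrite mpoly.mmeasure1.
by apply: msizeM_leq; first exact: msizeX_leq.
Qed.

Lemma msize_comp_affine (l : 'I_m -> Pol) p :
  (forall i, msize (l i) <= 2)%N ->
  (msize (mpoly.mmap (@mpoly.mpolyC m R) l p) <= msize p)%N.
Proof.
move=> hl; rewrite (mpoly.mmapE (msize p))//.
apply: msize_sum_leq => a; rewrite mpoly.mul_mpolyC.
rewrite (leq_trans (mpoly.msizeZ_le _ _))//.
by rewrite (leq_trans (msize_mmap1_affine _ hl))// mpoly.bmdeg.
Qed.

(** No cancellation occurs in a sum of squares over an ordered field: if a is
    the largest leading monomial of the q i, the coefficient of 2a in the sum is
    the sum of the squares of the coefficients of a, which is positive. *)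
Lemma msize_sum_sqr (I : finType) (q : I -> Pol) k :
  (msize (\sum_i q i ^+ 2) <= k.*2.+1)%N -> forall i, (msize (q i) <= k.+1)%N.
Proof.
move=> hS i; have [->|qi0] := eqVneq (q i) 0; first by rewrite mpoly.mmeasure0.
pose j := [arg max_(j > i | q j != 0) mpoly.mlead (q j)]%O.
pose a := mpoly.mlead (q j).
(* The zero polynomials are left out: their conventional leading monomial 0
   does not carry a nonzero coefficient. *)
have [qj0 lea] : q j != 0 /\ forall i', (mpoly.mlead (q i') <= a)%O.
  rewrite /a /j; case: Order.TotalTheory.arg_maxP => //= j' qj0 jm; split=> // i'.
  have [->|/jm//] := eqVneq (q i') 0.
  by rewrite mpoly.mlead0 mpoly.le0m.
have cE : mpoly.mcoeff (mpoly.mnm_add a a) (\sum_i q i ^+ 2) =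
    \sum_i (mpoly.mcoeff a (q i)) ^+ 2.
  rewrite raddf_sum /=; apply: eq_bigr => i' _.
  by rewrite !expr2 mpoly.mleadcMW.
have : mpoly.mcoeff (mpoly.mnm_add a a) (\sum_i q i ^+ 2) != 0.
  rewrite cE psumr_neq0; last by move=> *; exact: sqr_ge0.
  apply/hasP; exists j; first by rewrite mem_index_enum.
  by rewrite /= lt_neqAle sqr_ge0 andbT eq_sym sqrf_eq0 mpoly.mleadc_eq0.
rewrite -mpoly.mcoeff_msupp => /mpoly.msize_mdeg_lt /leq_trans /(_ hS).
rewrite mpoly.mdegD addnn ltnS leq_double => lek.
rewrite -mpoly.mlead_deg// ltnS (leq_trans _ lek)//.
exact: mpoly.lemc_mdeg.
Qed.

End Degrees.

Lemma pdeg_msize (R : realType) m (p : mpoly.mpoly m R) d :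
  (pdeg p <= d)%N -> (mpoly.mmeasure mpoly.mdeg p <= d.+1)%N.
Proof. by rewrite -ltnS; apply: leq_trans; exact: leqSpred. Qed.

(** * Jensen's inequality for SOS-convex polynomials *)

Lemma msize_mderiv (R : realType) m (p : mpoly.mpoly m R) j n :
  (mpoly.mmeasure mpoly.mdeg p <= n.+2)%N ->
  (mpoly.mmeasure mpoly.mdeg (mpoly.mderiv j p) <= n.+1)%N.
Proof.
move=> hp; have [->|dp0] := eqVneq (mpoly.mderiv j p) 0.
  by rewrite mpoly.mmeasure0.
have := dp0; rewrite -mpoly.mleadc_eq0 mpoly.mcoeff_deriv mulrn_eq0 negb_or.
rewrite -mpoly.mcoeff_msupp => /andP[_ /mpoly.msize_mdeg_lt /leq_trans/(_ hp)].
by rewrite mpoly.mdegD mpoly.mdeg1 addn1 !ltnS -mpoly.mlead_deg.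
Qed.

Section ChainRule.
Variables (R S : comNzRingType) (m : nat) (f : {rmorphism R -> {poly S}}).
Variable h : 'I_m -> {poly S}.
Hypothesis f_const : forall c, (f c)^`() = 0.
Local Notation Pol := (mpoly.mpoly m R).
Local Notation subst := (mpoly.mmap f h).

(** The set of p satisfying the chain rule is closed under sums and products and
    contains the constants and the variables. *)
Lemma deriv_mmap (p : Pol) :
  (subst p)^`() = \sum_j subst (mpoly.mderiv j p) * (h j)^`().
Proof.
pose D p := (subst p)^`() = \sum_j subst (mpoly.mderiv j p) * (h j)^`().
have DM p1 p2 : D p1 -> D p2 -> D (p1 * p2).
  rewrite /D rmorphM derivM => -> ->.
  rewrite mulr_suml mulr_sumr -big_split /=; apply: eq_bigr => j _.
  by rewrite mpoly.mderivM rmorphD !rmorphM /= mulrDl mulrAC mulrA.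
have DC c : D (mpoly.mpolyC m c).
  rewrite /D mpoly.mmapC f_const big1// => j _.
  by rewrite mpoly.mderivC rmorph0 mul0r.
have DX i : D (mpoly.mpolyX R (mpoly.mnm1 i)).
  rewrite /D mpoly.mmapX mpoly.mmap1U (bigD1 i)//= big1 ?addr0 => [|j ji].
    rewrite mpoly.mderivX mpoly.mnm1E eqxx scale1r.
    suff -> : mpoly.mnm_sub (mpoly.mnm1 i) (mpoly.mnm1 i) = mpoly.mnm0.
      by rewrite mpoly.mpolyX0 rmorph1 mul1r.
    by apply/mpoly.mnmP => k; rewrite mpoly.mnmBE mpoly.mnm0E subnn.
  by rewrite mpoly.mderivX mpoly.mnm1E eq_sym (negbTE ji) scale0r rmorph0 mul0r.
have D1 : D 1 by rewrite -[1]mpoly.mpolyC1.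
have DXm a : D (mpoly.mpolyX R a).
  rewrite mpoly.mpolyXE_id; elim/big_ind: _ => // i _.
  by elim: (a i) => [|n ih]; rewrite ?expr0 // exprS; apply: DM.
rewrite -/(D p); elim/mpoly.mpolyind: p => [|c a p _ _ Dp].
  by rewrite -[0](@mpoly.mpolyC0 m).
rewrite /D rmorphD derivD Dp -mpoly.mul_mpolyC DM// -big_split /=.
by apply: eq_bigr => j _; rewrite mpoly.mderivD rmorphD mulrDl.
Qed.

End ChainRule.

Lemma poly_convex_tangent (R : realType) (p : {poly R}) :
  (forall s, 0 <= p^`()^`().[s]) -> p.[0] + p^`().[0] <= p.[1].
Proof.
move=> p2; have [c] := @polyrcf.poly_mvt R 0 1 p ltr01.
rewrite in_itv /= subr0 mulr1 => /andP[c0 _] pE.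
have [e _] := @polyrcf.poly_mvt R 0 c p^`() c0.
rewrite subr0 => dE; have : 0 <= p^`().[c] - p^`().[0].
  by rewrite dE mulr_ge0// ltW.
by lra.
Qed.

Section Jensen.
Variables (R : realType) (m : nat).
Local Notation Pol := (mpoly.mpoly m R).
Local Notation msize := (@mpoly.mmeasure m R mpoly.mdeg).
Local Notation "c %:MP" := (mpoly.mpolyC m c).
Local Notation X_ i := (mpoly.mpolyX R (mpoly.mnm1 i)).
Local Notation ccoef := (@polyC Pol \o @mpoly.mpolyC m R).

(** The j-th diagonal entry of the Hessian is the sum of the squares of the
    entries of the j-th column of P, and it has degree at most deg f - 2. *)
Lemma sos_convex_factor_deg (f : Pol) k s (P : 'M[Pol]_(s, m)) :
  (msize f <= (k.+1).*2.+1)%N -> hessian f = P^T *m P ->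
  forall i j, (msize (P i j) <= k.+1)%N.
Proof.
move=> hf HP i j; apply: (@msize_sum_sqr _ _ _ (fun i => P i j)).
have -> : \sum_i P i j ^+ 2 = hessian f j j.
  by rewrite HP mxE; apply: eq_bigr => i' _; rewrite mxE expr2.
by rewrite mxE; do 2 apply: msize_mderiv.
Qed.

Variable u : 'I_m -> R.

(** The point u + s (X - u) as a polynomial in s, where X is the generic point. *)
Definition segment i : {poly Pol} := (u i)%:MP%:P + 'X * (X_ i - (u i)%:MP)%:P.

(** f (u + s (X - u)), with s the variable of the outer polynomial ring. *)
Definition along : Pol -> {poly Pol} := mpoly.mmap ccoef segment.

Lemma deriv_along f :
  (along f)^`() = \sum_j along (mpoly.mderiv j f) * (X_ j - (u j)%:MP)%:P.
Proof.
rewrite /along deriv_mmap => [|c]; last by rewrite /= derivC.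
by apply: eq_bigr => j _; rewrite /segment derivD derivM derivX !derivC mul1r mulr0 addr0 add0r.
Qed.

Lemma horner_along f (s : R) : (along f).[s%:MP] =
  mpoly.mmap (@mpoly.mpolyC m R)
    (fun i => (u i)%:MP + s%:MP * (X_ i - (u i)%:MP)) f.
Proof.
rewrite /along /mpoly.mmap horner_sum; apply: eq_bigr => a _.
rewrite hornerM hornerC /mpoly.mmap1 horner_prod; congr (_ * _).
by apply: eq_bigr => i _; rewrite horner_exp /segment !hornerE.
Qed.

Lemma along0 f : (along f).[0%:MP] = (mpoly.meval u f)%:MP.
Proof.
rewrite horner_along /mpoly.meval /mpoly.mmap raddf_sum /=.
apply: eq_bigr => a _; rewrite rmorphM rmorph_prod /=; congr (_ * _).
by apply: eq_bigr => i _; rewrite rmorphXn /= raddf0 mul0r addr0.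
Qed.

Lemma along1 f : (along f).[1%:MP] = f.
Proof.
rewrite horner_along [RHS]mpoly.mpolyE.
apply: eq_bigr => a _; rewrite mpoly.mul_mpolyC; congr (_ *: _).
rewrite -mpoly.mmap1_id; apply: mpoly.mmap1_eq => i.
by rewrite mpoly.mpolyC1 mul1r addrC subrK.
Qed.

Lemma msize_along f s : (msize (along f).[s%:MP] <= msize f)%N.
Proof.
rewrite horner_along; apply: msize_comp_affine => i.
have hC c k : (msize c%:MP <= k.+1)%N by rewrite mpoly.mmeasureC; case: eqP.
apply: msizeD_leq => //; apply: (@msizeM_leq _ _ 0 1) => //.
by apply: msizeD_leq; rewrite ?mpoly.mmeasureN// mpoly.msizeX mpoly.mdeg1.
Qed.

(** The second derivative in s is (X - u)^T H (X - u), with the Hessian H taken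
    at u + s (X - u); the factorization of H makes it a sum of squares. *)
Lemma deriv2_along f s (P : 'M[Pol]_(s, m)) : hessian f = P^T *m P ->
  (along f)^`()^`() =
  \sum_k (\sum_i along (P k i) * (X_ i - (u i)%:MP)%:P) ^+ 2.
Proof.
move=> HP; rewrite deriv_along raddf_sum /=.
under eq_bigr => j _ do rewrite derivM derivC mulr0 addr0 deriv_along mulr_suml.
under [RHS]eq_bigr => k _ do rewrite expr2 big_distrlr /=.
rewrite [RHS]exchange_big /=; apply: eq_bigr => j _.
rewrite [RHS]exchange_big /=; apply: eq_bigr => i _.
have -> : mpoly.mderiv i (mpoly.mderiv j f) = \sum_k P k i * P k j.
  have := congr1 (fun A : 'M[Pol]_m => A i j) HP; rewrite !mxE => ->.
  by apply: eq_bigr => k _; rewrite mxE.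
rewrite /along rmorph_sum /= !mulr_suml; apply: eq_bigr => k _.
by rewrite rmorphM -[LHS]mulrA [LHS]mulrACA [LHS]mulrC.
Qed.

End Jensen.

Section JensenInequality.
Variables (R : realType) (m : nat).
Local Notation Pol := (mpoly.mpoly m R).
Local Notation msize := (@mpoly.mmeasure m R mpoly.mdeg).
Local Notation X_ i := (mpoly.mpolyX R (mpoly.mnm1 i)).

Variable ell : {scalar Pol}.

Lemma deriv_map_scalar (w : {poly Pol}) :
  (map_poly ell w)^`() = map_poly ell w^`().
Proof.
by apply/polyP => i; rewrite coef_deriv !coef_map coef_deriv raddfMn.
Qed.

Lemma horner_map_scalar (w : {poly Pol}) (s : R) :
  (map_poly ell w).[s] = ell w.[mpoly.mpolyC m s].
Proof.
rewrite (@horner_coef_wide _ (size w)) ?size_poly// horner_coef raddf_sum /=.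
apply: eq_bigr => i _; rewrite coef_map /= -rmorphXn /= [in RHS]mulrC.
by rewrite mpoly.mul_mpolyC linearZ /= mulrC.
Qed.

(** Jensen inequality for a linear functional that resembles integration against
    a probability measure only on squares of bounded degree.  The polynomial phi
    below is convex because its second derivative is the value of ell at a sum of
    squares, and phi'(0) = sum_j d_j f(u) * (ell X_j - u_j) vanishes as u is the
    barycentre of ell. *)
Lemma sos_convex_jensen (f : Pol) k :
  (forall q, (msize q <= k.+2)%N -> 0 <= ell (q ^+ 2)) -> ell 1 = 1 ->
  (msize f <= (k.+1).*2.+1)%N -> sos_convex f ->
  mpoly.meval (fun i => ell (X_ i)) f <= ell f.
Proof.
move=> ell_sqr ell1 hf [s [P HP]]; pose u i := ell (X_ i).
have ellC c : ell (mpoly.mpolyC m c) = c.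
  by rewrite -mpoly.alg_mpolyC linearZ /= ell1 mulr1.
have degP := sos_convex_factor_deg hf HP.
pose phi := map_poly ell (along u f).
have phi2 t : 0 <= phi^`()^`().[t].
  rewrite !deriv_map_scalar (deriv2_along u HP) horner_map_scalar horner_sum.
  rewrite raddf_sum sumr_ge0// => i _; rewrite horner_exp; apply: ell_sqr.
  rewrite horner_sum; apply: msize_sum_leq => j; rewrite hornerM hornerC.
  rewrite -addn1; apply: msizeM_leq.
    by rewrite (leq_trans (msize_along _ _ _)).
  apply: msizeD_leq; first by rewrite mpoly.msizeX mpoly.mdeg1.
  by rewrite mpoly.mmeasureN mpoly.mmeasureC; case: eqP.
have := poly_convex_tangent phi2.
rewrite deriv_map_scalar !horner_map_scalar along0 along1 ellC deriv_along.
rewrite horner_sum raddf_sum big1 => [|j _].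
  by rewrite addr0.
rewrite hornerM hornerC along0 mpoly.mul_mpolyC /= linearZ /= raddfB /= ellC.
by rewrite subrr mulr0.
Qed.

End JensenInequality.

(** * The cone of positive semidefinite matrices *)

Section Entry11.
Variable R : comNzRingType.
Implicit Types B C : 'M[R]_1.

Lemma sub11 B C : (B - C) 0 0 = B 0 0 - C 0 0. Proof. by rewrite !mxE. Qed.

Lemma scale11 t B : (t *: B) 0 0 = t * B 0 0. Proof. by rewrite mxE. Qed.

End Entry11.

Section PsdTrace.
Variables (R : realType) (n : nat).
Implicit Types (A Z : 'M[R]_n) (x y : 'cV[R]_n).

Lemma quad_formE A x :
  (x^T *m A *m x) 0 0 = \sum_i \sum_j x i 0 * x j 0 * A i j.
Proof.
rewrite mxE exchange_big /=; apply: eq_bigr => j _.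
by rewrite mxE mulr_suml; apply: eq_bigr => i _; rewrite mxE mulrAC.
Qed.

Lemma quad_form_sub A x y t : sym_mx A ->
  ((x - t *: y)^T *m A *m (x - t *: y)) 0 0 =
  (x^T *m A *m x) 0 0 - 2 * t * (x^T *m A *m y) 0 0 +
  t ^+ 2 * (y^T *m A *m y) 0 0.
Proof.
move=> symA; have yx : (y^T *m A *m x) 0 0 = (x^T *m A *m y) 0 0.
  suff -> : y^T *m A *m x = (x^T *m A *m y)^T by rewrite mxE.
  by rewrite !trmx_mul trmxK symA mulmxA.
have -> : (x - t *: y)^T = x^T - t *: y^T by rewrite linearB linearZ.
rewrite !mulmxBl !mulmxBr -!scalemxAl -!scalemxAr.
rewrite !(sub11, scale11) yx; ring.
Qed.

Lemma psd_diag_ge0 A i : psd_mx A -> 0 <= A i i.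
Proof.
case=> _ /(_ (delta_mx i 0)).
by rewrite trmx_delta -rowE -colE !mxE.
Qed.

(** For a vanishing diagonal, the quadratic form at e_i - A_ij e_j equals
    -2 A_ij^2. *)
Lemma psd_diag0_eq0 A : psd_mx A -> (forall i, A i i = 0) -> A = 0.
Proof.
move=> [symA psdA] dA; apply/matrixP => i j; rewrite mxE.
have entry k l :
    ((delta_mx k 0 : 'cV[R]_n)^T *m A *m (delta_mx l 0 : 'cV[R]_n)) 0 0 = A k l.
  by rewrite trmx_delta -rowE -colE !mxE.
have := psdA (delta_mx i 0 - A i j *: delta_mx j 0).
rewrite quad_form_sub// !entry !dA => h; apply/eqP.
by rewrite -sqrf_eq0 eq_le sqr_ge0 andbT; lra.
Qed.

(** One step of symmetric elimination.  The new quadratic form at x is the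
    minimum over t of the old one at x - t e_i, attained at t = (A x)_i / A_ii. *)
Lemma psd_pivot A i : psd_mx A -> A i i != 0 ->
  psd_mx (A - (A i i)^-1 *: (col i A *m (col i A)^T)).
Proof.
move=> [symA psdA] Ai0; split=> [|x].
  by rewrite /sym_mx linearB linearZ /= trmx_mul trmxK symA.
set b := (x^T *m col i A) 0 0.
pose e : 'cV[R]_n := delta_mx i 0.
have eAe : (e^T *m A *m e) 0 0 = A i i.
  by rewrite /e trmx_delta -rowE -colE !mxE.
have zx : (col i A)^T *m x = (x^T *m col i A)^T by rewrite trmx_mul trmxK.
suff -> : (x^T *m (A - (A i i)^-1 *: (col i A *m (col i A)^T)) *m x) 0 0 =
    ((x - (b / A i i) *: e)^T *m A *m (x - (b / A i i) *: e)) 0 0 by exact: psdA.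
have xAe : x^T *m A *m e = x^T *m col i A by rewrite -mulmxA -colE.
rewrite quad_form_sub// eAe xAe -/b.
rewrite mulmxBr mulmxBl -scalemxAr -scalemxAl mulmxA -[X in _ *: X]mulmxA zx.
rewrite sub11 scale11 [(_ *m _^T) 0 0]mxE big_ord1 [_^T 0 0]mxE -/b.
by field.
Qed.

(** Self-duality of the positive semidefinite cone.  Symmetric elimination
    writes Z as a sum of rank one matrices z z^T / Z_ii, each of which contributes
    z^T A z / Z_ii to the trace; the induction is on the number of nonzero
    diagonal entries of Z. *)
Lemma psd_trace_ge0 Z A : psd_mx Z -> psd_mx A -> 0 <= \tr (Z *m A).
Proof.
move=> psdZ psdA; have [k] := ubnP #|[pred i | Z i i != 0]|.
elim: k Z psdZ => // k IH Z psdZ; rewrite ltnS => leZ.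
have [/existsP[i Zi0]|/existsPn Z0] := boolP [exists i, Z i i != 0]; last first.
  rewrite (psd_diag0_eq0 psdZ) ?mul0mx ?mxtrace0// => i.
  by apply/eqP; rewrite -[_ == _]negbK Z0.
set z := col i Z; set Z' := Z - (Z i i)^-1 *: (z *m z^T).
have psdZ' : psd_mx Z' by exact: psd_pivot.
have Z'E j : Z' j j = Z j j - (Z i i)^-1 * Z j i ^+ 2.
  by rewrite !mxE big_ord1 !mxE expr2.
have Zi_gt0 : 0 < Z i i by rewrite lt_neqAle eq_sym Zi0 psd_diag_ge0.
have : 0 <= \tr (Z' *m A).
  apply: IH => //; apply: leq_trans leZ; apply: proper_card; apply/properP; split.
    apply/fintype.subsetP => j; rewrite !inE; apply: contra => /eqP Zj0.
    rewrite eq_le psd_diag_ge0// andbT Z'E Zj0 sub0r oppr_le0.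
    by rewrite mulr_ge0 ?sqr_ge0// invr_ge0 ltW.
  by exists i; rewrite !inE ?Zi0// Z'E expr2 mulrA mulVf// mul1r subrr eqxx.
rewrite mulmxBl linearB /= subr_ge0 -scalemxAl linearZ /=; apply: le_trans.
rewrite mulr_ge0 ?invr_ge0 ?(ltW Zi_gt0)// -mulmxA mxtrace_mulC trace_mx11.
by case: psdA => _; apply.
Qed.

End PsdTrace.

Lemma psd_mxZ (R : realType) n (c : R) (A : 'M[R]_n) :
  0 <= c -> psd_mx A -> psd_mx (c *: A).
Proof.
move=> c0 [symA psdA]; split=> [|x]; first by rewrite /sym_mx linearZ /= symA.
by rewrite -scalemxAr -scalemxAl mxE mulr_ge0.
Qed.

(** * Riesz functionals and moment matrices *)

Section Riesz.
Variables (R : realType) (m d : nat).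
Local Notation Pol := (mpoly.mpoly m R).
Local Notation msize := (@mpoly.mmeasure m R mpoly.mdeg).
Implicit Types (y : expo m d -> R) (p q : Pol).

Lemma riesz_is_scalar y : scalar (riesz y).
Proof.
move=> c p q; rewrite /riesz mulr_sumr -big_split /=; apply: eq_bigr => a _.
by rewrite mpoly.mcoeffD mpoly.mcoeffZ; ring.
Qed.

HB.instance Definition _ y :=
  GRing.isLinear.Build R Pol R *%R (riesz y) (riesz_is_scalar y).

Lemma riesz_X y b : riesz y (mpoly.mpolyX R b) = at_expo y b.
Proof.
rewrite /riesz /at_expo; case: insubP => [a _ ab|bN] /=.
  rewrite (bigD1 a)//= big1 ?addr0 => [|c ca].
    by rewrite mpoly.mcoeffX -ab eqxx mulr1.
  by rewrite mpoly.mcoeffX -ab -mpoly.bmeqP eq_sym (negbTE ca) mulr0.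
rewrite big1// => c _; rewrite mpoly.mcoeffX.
case: eqP => [bc|]; last by rewrite mulr0.
by move: bN; rewrite bc mpoly.bmdeg.
Qed.

Lemma riesz1 y : riesz y 1 = y0 y.
Proof. by rewrite -mpoly.mpolyX0 riesz_X. Qed.

(** The monomials evaluated at v are the moments of the Dirac measure at v, so
    that identities between coefficients become identities between values. *)
Lemma riesz_meval v p : (msize p <= d.+1)%N ->
  riesz (fun a : expo m d => peval (mpoly.mpolyX R a) v) p = peval p v.
Proof.
move=> hp; rewrite [p in RHS](mpoly.mpolywE hp) /peval raddf_sum /=.
by apply: eq_bigr => a _; rewrite mpoly.mevalZ mulrC.
Qed.

(** The indicator of the exponent b is the coefficient function of X^b, which
    reduces the sum to values of the Riesz functional at 1 and at the X_i. *)
Lemma sum_FexpoE nu (F0 : 'M[R]_nu) (F : 'I_m -> 'M[R]_nu) y :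
  \sum_a y a *: Fexpo F0 F a = y0 y *: F0 + \sum_i y1 y i *: F i.
Proof.
have FE (a : mpoly.multinom m) : Fexpo F0 F a =
    mpoly.mcoeff a (1 : Pol) *: F0 +
    \sum_i mpoly.mcoeff a (mpoly.mpolyX R (mpoly.mnm1 i)) *: F i.
  rewrite /Fexpo -mpoly.mpolyX0 mpoly.mcoeffX eq_sym.
  have [<-|a0] := eqVneq (mpoly.mnm0 : mpoly.multinom m) a.
    rewrite scale1r big1 ?addr0// => i _.
    by rewrite mpoly.mcoeffX mpoly.mnm1_eq0 scale0r.
  rewrite scale0r add0r; case: pickP => [i /eqP ->|aN].
    rewrite (bigD1 i)//= mpoly.mcoeffX eqxx scale1r big1 ?addr0// => j ji.
    by rewrite mpoly.mcoeffX mpoly.eq_mnm1 (negbTE ji) scale0r.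
  by rewrite big1// => i _; rewrite mpoly.mcoeffX eq_sym aN scale0r.
under eq_bigr => a _ do rewrite FE scalerDr scalerA scaler_sumr.
rewrite big_split /= -scaler_suml -/(riesz y 1) riesz1; congr (_ + _).
rewrite exchange_big /=; apply: eq_bigr => i _.
under eq_bigr => a _ do rewrite scalerA.
by rewrite -scaler_suml -/(riesz y _) riesz_X.
Qed.

(** The matrix sum_a y_a B_a is the Gram matrix, in the monomial basis, of the
    bilinear form (p, q) |-> L_y (p q). *)
Lemma moment_quad_form y (x : 'cV[R]_(half_size m d)) :
  (x^T *m (\sum_a y a *: Bmx R a) *m x) 0 0 =
  riesz y ((\sum_i x i 0 *: monomials R m d i 0) ^+ 2).
Proof.
rewrite quad_formE expr2 big_distrlr /= raddf_sum; apply: eq_bigr => i _.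
rewrite raddf_sum; apply: eq_bigr => j _ /=.
set p := monomials R m d i 0; set q := monomials R m d j 0.
have -> : (x i 0 *: p) * (x j 0 *: q) = (x i 0 * x j 0) *: (p * q).
  by rewrite -!mpoly.mul_mpolyC mpoly.mpolyCM mulrACA.
rewrite linearZ /=; congr (_ * _); rewrite {}/p {}/q.
rewrite summxE /riesz; apply: eq_bigr => a _.
by rewrite !mxE big_ord1 !mxE.
Qed.

Lemma sum_monomials p : (msize p <= d./2.+1)%N ->
  exists x : 'cV[R]_(half_size m d), p = \sum_i x i 0 *: monomials R m d i 0.
Proof.
move=> hp; exists (\col_i mpoly.mcoeff (enum_val i : mpoly.bmultinom m d./2.+1) p).
rewrite [LHS](mpoly.mpolywE hp).
rewrite (reindex (@enum_val _ {: mpoly.bmultinom m d./2.+1}))/=.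
  by apply: eq_bigr => i _; rewrite !mxE.
by apply: onW_bij; exact: enum_val_bij.
Qed.

Lemma moment_psd_sqr y p : psd_mx (\sum_a y a *: Bmx R a) ->
  (msize p <= d./2.+1)%N -> 0 <= riesz y (p ^+ 2).
Proof.
by move=> [_ psdM] /sum_monomials[x ->]; rewrite -moment_quad_form.
Qed.

Lemma Bmx_sym a : sym_mx (Bmx R a : 'M[R]_(half_size m d)).
Proof.
rewrite /sym_mx /Bmx; apply/matrixP => i j.
by rewrite !mxE !big_ord1 !mxE mulrC.
Qed.

(** At the moments of a point the matrix is y(v) y(v)^T: its quadratic form is
    the square of the value at v. *)
Lemma moment_mx_eval_psd v : ~~ odd d ->
  psd_mx (\sum_a peval (mpoly.mpolyX R (a : expo m d)) v *: Bmx R a).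
Proof.
move=> d_even; split=> [|x].
  rewrite /sym_mx linear_sum; apply: eq_bigr => a _.
  by rewrite linearZ /= Bmx_sym.
rewrite moment_quad_form riesz_meval; first by rewrite /peval rmorphXn sqr_ge0.
have hs : (msize (\sum_i x i 0 *: monomials R m d i 0) <= d./2.+1)%N.
  apply: msize_sum_leq => i; rewrite (leq_trans (mpoly.msizeZ_le _ _))// mxE.
  by rewrite mpoly.msizeX mpoly.bmdeg.
rewrite expr2 (leq_trans (msizeM_leq hs hs))// addnn.
by rewrite -[d in leqRHS]odd_double_half (negbTE d_even).
Qed.

(** The Jensen inequality for the functional normalized by its mass y_0, whose
    barycentre is then y_(e_i) / y_0. *)
Lemma riesz_jensen y f : (2 <= d)%N -> ~~ odd d ->
  psd_mx (\sum_a y a *: Bmx R a) -> 0 < y0 y ->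
  (msize f <= d.+1)%N -> sos_convex f ->
  y0 y * mpoly.meval (fun i => (y0 y)^-1 * y1 y i) f <= riesz y f.
Proof.
move=> d2 d_even psdM y_gt0 hf f_sos.
pose c := (y0 y)^-1; pose y' a := c * y a.
have rE p : riesz y' p = c * riesz y p.
  by rewrite /riesz mulr_sumr; apply: eq_bigr => a _; rewrite mulrA.
have dE : d = ((d./2.-1).+1.*2)%N.
  by rewrite -[LHS]odd_double_half (negbTE d_even) prednK// half_gt0.
rewrite -ler_pdivlMl// -/c -rE.
rewrite (@mpoly.meval_eq _ _ _
  (fun i => riesz y' (mpoly.mpolyX R (mpoly.mnm1 i)))).
  apply: (@sos_convex_jensen _ _ _ _ d./2.-1) => //.
  - move=> q hq; rewrite /= rE mulr_ge0 ?moment_psd_sqr// ?invr_ge0 ?(ltW y_gt0)//.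
    by rewrite (leq_trans hq)// prednK// half_gt0.
  - by rewrite /= rE riesz1 mulVf// gt_eqF.
  - by rewrite -dE.
by move=> i; rewrite rE riesz_X.
Qed.

End Riesz.

(** * Bounds and continuity of the integrands *)

Section MinMax.
Variables (R : realType) (m r L : nat).
Variable g : 'I_r.+1 -> 'I_L.+1 -> mpoly.mpoly m R.
Implicit Type v : 'rV[R]_m.

Lemma minmax_le v k z :
  (forall l, peval (g k l) v <= z) -> minmax g v <= z.
Proof.
move=> gz; apply: (le_trans (bigmin_le _ k _)).
by apply: bigmax_le => // l _; exact: gz.
Qed.

(** A maximum is at least every convex combination. *)
Lemma minmax_ge v c (delta : 'I_r.+1 -> 'I_L.+1 -> R) :
  (forall k l, 0 <= delta k l) -> (forall k, \sum_l delta k l = 1) ->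
  (forall k, c <= \sum_l delta k l * peval (g k l) v) -> c <= minmax g v.
Proof.
move=> d0 d1 hc.
have cmax k : c <= \big[Num.max/peval (g k ord0) v]_l peval (g k l) v.
  apply: (le_trans (hc k)); set M := \big[Num.max/_]_l _.
  rewrite -[M]mul1r -(d1 k) mulr_suml; apply: ler_sum => l _.
  by rewrite ler_wpM2l//; exact: le_bigmax.
by apply: le_bigmin.
Qed.

Lemma continuous_bigop (I : Type) (s : seq I) (op : R -> R -> R)
    (F : I -> 'rV[R]_m -> R) F0 :
  (forall f1 f2 : 'rV[R]_m -> R, continuous f1 -> continuous f2 ->
     continuous (fun v => op (f1 v) (f2 v))) ->
  continuous F0 -> (forall i, continuous (F i)) ->
  continuous (fun v => \big[op/F0 v]_(i <- s) F i v).
Proof.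
move=> hop hF0 hF; elim: s => [|i s ih].
  by under [X in continuous X]eq_fun do rewrite big_nil.
by under [X in continuous X]eq_fun do rewrite big_cons; apply: hop.
Qed.

Lemma peval_continuous (p : mpoly.mpoly m R) : continuous (peval p).
Proof.
apply: (@continuous_bigop _ _ +%R _ (cst 0)) => [f1 f2 c1 c2 v| |a].
- exact: (cvgD (c1 v) (c2 v)).
- exact: cst_continuous.
have monC : continuous (fun v : 'rV[R]_m => \prod_i v 0 i ^+ a i).
  apply: (@continuous_bigop _ _ *%R _ (cst 1)) => [f1 f2 c1 c2 v| |i v].
  - exact: (cvgM (c1 v) (c2 v)).
  - exact: cst_continuous.
  apply: (@continuous_comp _ _ _ (fun v : 'rV[R]_m => v 0 i)
                                 (fun x => x ^+ a i)).
    exact: coord_continuous.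
  exact: exprn_continuous.
move=> v; exact: (cvgM (cvg_cst (mpoly.mcoeff a p)) (monC v)).
Qed.

Lemma minmax_continuous : continuous (minmax g).
Proof.
have hmax k :
    continuous (fun v => \big[Num.max/peval (g k ord0) v]_l peval (g k l) v).
  apply: continuous_bigop => [f1 f2 c1 c2 v| |l]; try exact: peval_continuous.
  exact: (@continuous_max _ _ f1 f2 v (c1 v) (c2 v)).
apply: continuous_bigop => // f1 f2 c1 c2 v.
exact: (@continuous_min _ _ f1 f2 v (c1 v) (c2 v)).
Qed.

End MinMax.

(** * Integration against nonnegative charges *)

Section NonnegativeCharge.
Context d (T : measurableType d) (R : realType).
Local Open Scope ereal_scope.
Variable mu : {charge set T -> \bar R}.
Hypothesis mu_ge0 : charge_ge0 mu.

(** On a measurable subset of a negative set, a nonnegative charge is both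
    nonpositive and nonnegative, whatever Hahn decomposition is chosen. *)
Lemma jordan_neg_charge_ge0 A :
  measurable A -> jordan_neg (hahn_posneg mu) A = 0.
Proof.
move=> mA; apply/eqP; rewrite eq_le measure_ge0 andbT.
rewrite jordan_negE cjordan_negE oppe_le0 /crestr0 mem_set// /crestr.
apply: mu_ge0; apply: measurableI => //.
by have [_ []] := hahn_posneg mu.
Qed.

Lemma jordan_pos_charge_ge0 A :
  measurable A -> jordan_pos (hahn_posneg mu) A = mu A.
Proof.
move=> mA; have := jordan_decomp (hahn_posneg mu) mA.
by rewrite /cadd /= /cscale /= jordan_neg_charge_ge0// mule0 adde0 => ->.
Qed.

Lemma charge_variation_ge0 A : measurable A ->
  charge_variation (hahn_posneg mu) A = mu A.
Proof.
move=> mA; rewrite /charge_variation /= jordan_pos_charge_ge0//.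
by rewrite jordan_neg_charge_ge0// adde0.
Qed.

Lemma charge_integral_ge0 f :
  charge_integral mu f = \int[jordan_pos (hahn_posneg mu)]_w (f w)%:E.
Proof.
rewrite /charge_integral [X in _ - X](_ : _ = 0) ?sube0//.
rewrite (eq_measure_integral mzero) ?integral_measure_zero// => A mA _.
exact: jordan_neg_charge_ge0.
Qed.

End NonnegativeCharge.

Section DiracCombination.
Context d (T : measurableType d) (R : realType) (n : nat).
Variables (P : pred 'I_n) (c : 'I_n -> R) (u : 'I_n -> T).
Hypothesis c_ge0 : forall i, (0 <= c i)%R.
Local Notation nu := (dirac_comb P c u).

Lemma dirac_comb_ge0 : charge_ge0 nu.
Proof.
move=> A mA; rewrite dirac_combE; apply: sume_ge0 => i _.
by rewrite mule_ge0// lee_fin.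
Qed.

(** The combination rebuilt as a sum of measures indexed by nat; the default
   values are taken only by indices that are at least n or outside P. *)
Let weight (k : nat) : {nonneg R} :=
  if insub k is Some i then if P i then NngNum (c_ge0 i) else 0%:nng else 0%:nng.

Let atom (k : nat) : {measure set T -> \bar R} :=
  if insub k is Some i then dirac (u i : T) else mzero.

(** The positive part of the charge agrees on measurable sets with a finite sum
    of scaled Dirac measures.  Integrals of nonnegative functions are additive in
    the measure; the general case follows from f = f^+ - f^-. *)
Lemma integral_dirac_comb (f : T -> R) : measurable_fun setT f ->
  (charge_integral nu f = (\sum_(i | P i) c i * f (u i))%:E)%E.
Proof.
move=> mf; rewrite (charge_integral_ge0 dirac_comb_ge0).
pose m_ k : {measure set T -> \bar R} := mscale (weight k) (atom k).
have mE A : measurable A -> A `<=` setT ->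
    jordan_pos (hahn_posneg nu) A = msum m_ n A.
  move=> mA _; rewrite (jordan_pos_charge_ge0 dirac_comb_ge0)// dirac_combE.
  rewrite /msum [LHS]big_mkcond; apply: eq_bigr => i _.
  rewrite /m_ /= /weight /atom valK /mscale.
  by case: (P i) => //=; rewrite mul0e.
rewrite (eq_measure_integral (msum m_ n))//.
have intg (h : T -> R) : measurable_fun setT h -> (forall x, 0 <= h x) ->
    (\int[msum m_ n]_x (h x)%:E = (\sum_(i | P i) c i * h (u i))%:E)%E.
  move=> mh h0; have /measurable_EFinP mh' := mh.
  rewrite ge0_integral_measure_sum//; last by move=> x _; rewrite lee_fin.
  rewrite -sumEFin [RHS]big_mkcond; apply: eq_bigr => i _.
  rewrite ge0_integral_mscale//; last by move=> x _; rewrite lee_fin.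
  rewrite /weight /atom valK integral_dirac// diracT mul1e.
  by case: (P i) => //=; rewrite mul0e.
have posE x : ((EFin \o f)^\+ x)%E = (f^\+ x)%:E.
  by rewrite funeposE -EFin_max.
have negE x : ((EFin \o f)^\- x)%E = (f^\- x)%:E.
  by rewrite funenegE -EFinN -EFin_max.
rewrite integralE.
under eq_integral do rewrite posE.
under [X in (_ - X)%E]eq_integral do rewrite negE.
rewrite (intg _ (measurable_funrpos mf) (funrpos_ge0 f)).
rewrite (intg _ (measurable_funrneg mf) (funrneg_ge0 f)).
rewrite -EFinB -sumrB; congr _%:E; apply: eq_bigr => i _.
by rewrite -mulrBr -[in RHS](funrposBneg f).
Qed.

End DiracCombination.

(** * Borel measures on a subspace *)

Section BorelSubspace.
Variables (R : realType) (X : topologicalType) (A : set X) (A0 : A !=set0).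

Lemma open_borel_val_preimage (U : set X) :
  open U -> open (@borel_val X A A0 @^-1` U : set (subspace_of A0)).
Proof. by move=> oU; exists U. Qed.

Lemma measurable_borel_val (f : X -> R) :
  continuous f -> measurable_fun setT (fun w : borel A0 => f (borel_val w)).
Proof.
move=> /continuousP cf.
apply: (measurability _ (RGenOpens.measurableE R)) => _ [_ [a [b ->]] <-].
rewrite setTI; apply: sub_sigma_algebra.
have /open_borel_val_preimage : open (f @^-1` `]a, b[).
  by apply: cf; exact: itv_open.
by [].
Qed.

(** A continuous function is bounded on the compact set A. *)
Lemma integrable_borel_val (mu : {finite_measure set (borel A0) -> \bar R})
    (f : X -> R) :
  compact A -> continuous f ->
  mu.-integrable setT (fun w : borel A0 => (f (borel_val w))%:E).
Proof.
move=> cA cf; apply: measurable_bounded_integrable => //.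
- by rewrite -ge0_fin_numE// fin_num_measure.
- exact: measurable_borel_val.
have : compact (f @` A).
  by apply: continuous_compact => //; exact: continuous_subspaceT.
move=> /compact_bounded [M [Mreal MP]]; exists M; split=> // x Mx w _ /=.
by apply: MP => //; exists (borel_val w) => //; exact: set_valP.
Qed.

Lemma accessible_borel_subspace :
  accessible_space X -> accessible_space (subspace_of A0).
Proof.
move=> aX x y xy; have [|U [oU Ux Uy]] := aX (set_val x) (set_val y).
  by apply: contra xy => /eqP /val_inj ->.
exists (@borel_val X A A0 @^-1` U); split; first exact: open_borel_val_preimage.
  by rewrite inE; rewrite inE in Ux.
by rewrite inE; rewrite inE in Uy.
Qed.

(** Every Borel set E is approximated without error: from inside by the set of
    the atoms in E, and from outside by the complement of the set of the atoms
    that are not in E. *)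
Lemma dirac_comb_regular (n : nat) (P : pred 'I_n) (c : 'I_n -> R)
    (u : 'I_n -> borel A0) : accessible_space X -> (forall i, 0 <= c i) ->
  regular_charge (dirac_comb P c u).
Proof.
move=> /accessible_borel_subspace aS c_ge0 E e mE e0.
pose K : set (subspace_of A0) := [set w | E w /\ exists i, w = u i].
pose F : set (subspace_of A0) := [set w | ~ E w /\ exists i, w = u i].
have fin (B : set (subspace_of A0)) : B `<=` range u -> finite_set B.
  by move=> /sub_finite_set; apply; apply: finite_image; exact: finite_finset.
have fK : finite_set K by apply: fin => w [_ [i ->]]; exists i.
have fF : finite_set F by apply: fin => w [_ [i ->]]; exists i.
have openC (B : set (subspace_of A0)) : finite_set B -> open (~` B).
  by move=> fB; apply: closed_openC; exact: accessible_finite_set_closed.1.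
exists K, (~` F); split.
- exact: finite_compact.
- exact: openC.
- by move=> w [].
- by move=> w Ew [].
have mO (B : set (subspace_of A0)) : open B -> measurable (B : set (borel A0)).
  exact: sub_sigma_algebra.
have mD : measurable ((~` F `\` K) : set (borel A0)).
  by apply: measurableI; apply: mO; exact: openC.
rewrite (charge_variation_ge0 (dirac_comb_ge0 _ _ c_ge0))// dirac_combE.
rewrite big1 ?lte_fin// => i _.
rewrite diracE memNset ?mule0// => -[nF nK].
by have [Ei|Ei] := pselect (E (u i)); [apply: nK|apply: nF]; split=> //; exists i.
Qed.

End BorelSubspace.

(** * Weak duality *)

Section WeakDuality.
Variables (R : realType) (m N nu r L J d : nat).
Variables (F0 : 'M[R]_nu) (F : 'I_m -> 'M[R]_nu) (M : 'I_N -> 'M[R]_nu).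
Variables (g : 'I_r.+1 -> 'I_L.+1 -> mpoly.mpoly m R).
Variables (h : 'I_J -> mpoly.mpoly m R) (gamma : 'I_J -> R).
Local Notation msize := (@mpoly.mmeasure m R mpoly.mdeg).
Hypotheses (d_ge2 : (2 <= d)%N) (d_even : ~~ odd d).
Hypothesis g_deg : forall k l, (msize (g k l) <= d.+1)%N.
Hypothesis h_deg : forall j, (msize (h j) <= d.+1)%N.
Variable x : Rvar R m nu r L J d.
Hypothesis x_feasible : R_feasible F0 F M g h x.
Local Notation Omega := (proj_spectrahedron F0 F M).

(** The coefficient equations, multiplied by the monomials at v and added up,
    express the left-hand side as the sum of two traces of products of positive
    semidefinite matrices. *)
Lemma lagrangian_ge0 k v : Omega v ->
  0 <= \sum_l Rdelta x k l * peval (g k l) v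
       + \sum_j Rlambda x j * peval (h j) v + Rmass x.
Proof.
move=> [xi psdA]; have [_ /(_ k) [_ psdZ psdQ coefE trM]] := x_feasible.
pose y (a : expo m d) : R := peval (mpoly.mpolyX R a) v.
have Ey1 : riesz y 1 = 1.
  by rewrite riesz_meval ?mpoly.mmeasure1// /peval rmorph1.
(* Z is orthogonal to every M_t, so xi does not contribute. *)
have trF : \tr (RZ x k *m pencil F0 F M v xi) =
    \sum_a y a * \tr (RZ x k *m Fexpo F0 F a).
  rewrite /pencil mulmxDr mxtraceD mulmx_sumr [X in _ + X = _]raddf_sum /=.
  rewrite [X in _ + X = _]big1 ?addr0 => [|t _]; last first.
    by rewrite -scalemxAr mxtraceZ trM mulr0.
  under [RHS]eq_bigr => a _ do rewrite -mxtraceZ scalemxAr.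
  rewrite -raddf_sum -mulmx_sumr /= sum_FexpoE -riesz1 Ey1 scale1r.
  congr (\tr (_ *m (_ + _))); apply: eq_bigr => i _; congr (_ *: _).
  rewrite /y1 -riesz_X riesz_meval; first by rewrite /peval mpoly.mevalXU.
  by rewrite mpoly.msizeX mpoly.mdeg1 ltnS ltnW.
have trQ : \sum_a y a * \tr (RQ x k *m Bmx R a) =
    \tr (RQ x k *m (\sum_a y a *: Bmx R a)).
  rewrite mulmx_sumr raddf_sum /=; apply: eq_bigr => a _.
  by rewrite -scalemxAr mxtraceZ.
have := psd_trace_ge0 psdQ (moment_mx_eval_psd v d_even); rewrite -trQ.
under eq_bigr => a _ do rewrite -coefE mulrBr !mulrDr.
rewrite sumrB -trF !big_split /=.
under eq_bigr => a _ do rewrite mulr_sumr.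
rewrite exchange_big /=.
under [X in _ + X + _]eq_bigr => a _ do rewrite mulr_sumr.
rewrite [X in _ + X + _]exchange_big /=.
have rieszE (I : finType) (c : I -> R) (f : I -> mpoly.mpoly m R) :
    (forall i, msize (f i) <= d.+1)%N ->
    \sum_i \sum_(a : expo m d) y a * (c i * mpoly.mcoeff a (f i)) =
    \sum_i c i * peval (f i) v.
  move=> hf; apply: eq_bigr => i _.
  rewrite -(riesz_meval _ (hf i)) /riesz mulr_sumr.
  by apply: eq_bigr => a _; rewrite mulrCA.
rewrite (rieszE _ (fun l => Rdelta x k l))// rieszE//.
have -> : \sum_(a : expo m d) y a * (Rmass x * mpoly.mcoeff a 1) = Rmass x.
  rewrite -[RHS]mulr1 -Ey1 /riesz mulr_sumr; apply: eq_bigr => a _.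
  by rewrite mulrCA.
move=> /le_trans; apply; rewrite lerBlDr lerDl.
exact: psd_trace_ge0.
Qed.

Lemma minmax_ge_lagrange v : Omega v ->
  0 <= minmax g v + (\sum_j Rlambda x j * peval (h j) v + Rmass x).
Proof.
move=> Omegav; rewrite -[X in 0 <= _ + X]opprK subr_ge0.
have delta_simplex k := let: And5 D _ _ _ _ := x_feasible.2 k in D.
apply: (@minmax_ge _ _ _ _ _ _ _ (Rdelta x)) => [k l|k|k].
- exact: (delta_simplex k).1.
- exact: (delta_simplex k).2.
by have := lagrangian_ge0 k Omegav; lra.
Qed.

Hypothesis Omega0 : Omega !=set0.
Hypothesis Omega_compact : compact Omega.

Lemma weak_duality mu : P_feasible h gamma Omega0 mu ->
  ((R_objective gamma x)%:E <= P_objective g Omega0 mu)%E.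
Proof.
move=> [_ mu_h mu_1 mu_ge0]; rewrite /P_objective.
pose nu' := jordan_pos (hahn_posneg mu).
have chE f : integral_on mu f = (\int[nu']_w (f (borel_val w))%:E)%E.
  exact: charge_integral_ge0.
rewrite chE; rewrite chE in mu_1.
have {}mu_h j : (\int[nu']_w (peval (h j) (borel_val w))%:E <= (gamma j)%:E)%E.
  by rewrite -chE.
have int f : continuous f ->
    nu'.-integrable setT (fun w : borel Omega0 => (f (borel_val w))%:E).
  exact: integrable_borel_val.
have int_h j : nu'.-integrable setT (fun w : borel Omega0 =>
    ((Rlambda x j)%:E * (peval (h j) (borel_val w))%:E)%E).
  by apply: integrableZl => //; apply: int; exact: peval_continuous.
have int_sum : nu'.-integrable setT (fun w : borel Omega0 =>
    \sum_j ((Rlambda x j)%:E * (peval (h j) (borel_val w))%:E)%E).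
  exact: integrable_sum.
have int_1 : nu'.-integrable setT (fun w : borel Omega0 =>
    ((Rmass x)%:E * (cst 1 (borel_val w))%:E)%E).
  apply: integrableZl => //; apply: int; exact: cst_continuous.
have : (0 <= \int[nu']_w ((minmax g (borel_val w))%:E +
    (\sum_j ((Rlambda x j)%:E * (peval (h j) (borel_val w))%:E) +
     (Rmass x)%:E * (cst 1 (borel_val w))%:E)))%E.
  apply: integral_ge0 => w _.
  under eq_bigr => j _ do rewrite -EFinM.
  rewrite sumEFin -EFinM -!EFinD lee_fin mulr1; apply: minmax_ge_lagrange.
  exact: set_valP.
rewrite integralD//; [|by apply: int; exact: minmax_continuous|exact: integrableD].
rewrite integralD// integral_sum//.
under eq_bigr => j _.
  rewrite integralZl//; last by apply: int; exact: peval_continuous.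
  over.
rewrite integralZl//; last by apply: int; exact: cst_continuous.
rewrite mu_1 mule1.
have le_gamma : (\sum_j
    ((Rlambda x j)%:E * \int[nu']_w (peval (h j) (borel_val w))%:E) <=
    (\sum_j Rlambda x j * gamma j)%:E)%E.
  rewrite -sumEFin; apply: lee_sum => j _; rewrite EFinM.
  apply: lee_wpmul2l; last exact: mu_h.
  by rewrite lee_fin; exact: x_feasible.1.
set I := (\int[nu']_w (minmax g (borel_val w))%:E)%E => I0.
have {I0} : (0 <= I + (\sum_j Rlambda x j * gamma j + Rmass x)%:E)%E.
  by apply: (le_trans I0); rewrite leeD2l// EFinD leeD2r.
case: I => [s| |] //; last by move=> _; rewrite leey.
by rewrite -EFinD !lee_fin /R_objective; lra.
Qed.

End WeakDuality.

(** * Optimality of the atomic measure *)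

Unset Implicit Arguments.

Theorem theorem3p6 (R : realType) (m N nu r L J d : nat)
    (F0 : 'M[R]_nu) (F : 'I_m -> 'M[R]_nu) (M : 'I_N -> 'M[R]_nu)
    (g : 'I_r.+1 -> 'I_L.+1 -> mpoly.mpoly m R) (h : 'I_J -> mpoly.mpoly m R)
    (gamma : 'I_J -> R)
    (F0_sym : sym_mx F0) (F_sym : forall i, sym_mx (F i))
    (M_sym : forall t, sym_mx (M t))
    (g_sos : forall k l, sos_convex (g k l))
    (h_sos : forall j, sos_convex (h j))
    (d_least : least_even_degree g h d) (d_ge2 : (2 <= d)%N)
    (Omega_compact : compact (proj_spectrahedron F0 F M))
    (slater : exists (v : 'rV[R]_m) (xi : 'rV[R]_N), pd_mx (pencil F0 F M v xi))
    (Omega0 := slater_nonempty slater)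
    (gamma_interior : interior_condition h gamma Omega0)
    (P_attained : exists mu, minimizer (P_feasible h gamma Omega0)
                                       (P_objective g Omega0) mu)
    (maxR_eq_minS : exists (x : Rvar R m nu r L J d) (s : Svar R m N r d),
      [/\ maximizer (R_feasible F0 F M g h) (R_objective gamma) x,
          minimizer (S_feasible F0 F M g h gamma) S_objective s &
          R_objective gamma x = S_objective s])
    (sbar : Svar R m N r d)
    (sbar_min : minimizer (S_feasible F0 F M g h gamma)
                          S_objective sbar)
    (y0_ge0 : forall k, 0 <= y0 (Sy sbar k))
    (K := [pred k : 'I_r.+1 | 0 < y0 (Sy sbar k)])
    (uhat := fun k => (y0 (Sy sbar k))^-1 *: \row_i y1 (Sy sbar k) i)
    (outside_K : forall k, k \notin K ->
      0 <= Sz sbar k /\ forall j, 0 <= riesz (Sy sbar k) (h j)) :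
  exists u : 'I_r.+1 -> borel Omega0,
    (forall k, k \in K -> borel_val (u k) = uhat k) /\
    minimizer (P_feasible h gamma Omega0) (P_objective g Omega0)
      (dirac_comb K (fun k => y0 (Sy sbar k)) u).
Proof.
have [[d_even /(_ _ _)/pdeg_msize-g_deg /(_ _)/pdeg_msize-h_deg] _] := d_least.
have [x [s [[x_feas _] [s_feas s_min] xs]]] := maxR_eq_minS.
have [[sbar_h sbar_g sbar_psd sbar_mass sbar_mom] sbar_opt] := sbar_min.
have notK k : k \notin K -> y0 (Sy sbar k) = 0.
  by rewrite inE -leNgt => y_le0; apply/eqP; rewrite eq_le y_le0 y0_ge0.
have uhat_Omega k : k \in K -> proj_spectrahedron F0 F M (uhat k).
  rewrite inE => yk_gt0; exists ((y0 (Sy sbar k))^-1 *: Sxi sbar k).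
  have yk_ge0 : 0 <= (y0 (Sy sbar k))^-1 by rewrite invr_ge0 ltW.
  have := psd_mxZ yk_ge0 (sbar_psd k).
  rewrite !scalerDr scalerA mulVf ?gt_eqF// scale1r !scaler_sumr.
  rewrite /pencil /uhat; congr (psd_mx (_ + _ + _)); apply: eq_bigr => i _.
    by rewrite scalerA !mxE.
  by rewrite scalerA !mxE.
(* Outside K the atom has weight 0 and its position is arbitrary. *)
have /boolp.choice[u uP] k :
    exists w : borel Omega0, k \in K -> borel_val w = uhat k.
  have [/uhat_Omega Ouk|kNK] := boolP (k \in K); last by exists point.
  by exists (SigSub (mem_set Ouk)).
exists u; split=> //.
have jensen k f : k \in K ->
    (mpoly.mmeasure mpoly.mdeg f <= d.+1)%N -> sos_convex f ->
    y0 (Sy sbar k) * peval f (borel_val (u k)) <= riesz (Sy sbar k) f.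
  move=> kK hf f_sos; rewrite uP// /peval.
  rewrite (@mpoly.meval_eq _ _ _
    (fun i => (y0 (Sy sbar k))^-1 * y1 (Sy sbar k) i)); last first.
    by move=> i; rewrite !mxE.
  by apply: riesz_jensen => //; rewrite inE in kK.
have integral_muhat f : continuous f ->
    integral_on (dirac_comb K (fun k => y0 (Sy sbar k)) u) f =
    (\sum_(k | K k) y0 (Sy sbar k) * f (borel_val (u k)))%:E.
  move=> cf; rewrite /integral_on integral_dirac_comb//.
  exact: measurable_borel_val.
split; first split.
- apply: dirac_comb_regular => //.
  by apply: hausdorff_accessible; exact: norm_hausdorff.
- move=> j; rewrite integral_muhat; last exact: peval_continuous.
  rewrite lee_fin; apply: le_trans (sbar_h j).
  rewrite big_mkcond; apply: ler_sum => k _.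
  case: ifPn => [kK|/outside_K[_]//]; exact: jensen.
- rewrite integral_muhat; last exact: cst_continuous.
  congr (_%:E); rewrite -[RHS]sbar_mass [RHS](bigID K) /= [X in _ = _ + X]big1.
    by rewrite addr0; apply: eq_bigr => k _; rewrite mulr1.
  by move=> k /notK.
- exact: dirac_comb_ge0.
move=> mu mu_feas.
have := weak_duality d_ge2 d_even g_deg h_deg x_feas Omega_compact mu_feas.
apply: le_trans.
rewrite /P_objective integral_muhat; last exact: minmax_continuous.
rewrite lee_fin xs; apply: le_trans (sbar_opt _ s_feas).
rewrite /S_objective big_mkcond; apply: ler_sum => k _.
case: ifPn => [kK|/outside_K[]//].
have yk_gt0 : 0 < y0 (Sy sbar k) by [].
rewrite -ler_pdivlMl//; apply: (@minmax_le _ _ _ _ _ _ k) => l.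
rewrite ler_pdivlMl//; exact: le_trans (jensen _ _ _ _ _) (sbar_g l k).
Qed.
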